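(* Let $\Sigma$ be a signature, $\mathbf{K}$ a quasivariety of $\Sigma$-structures and $\tau$ a finite set of equations in at most one variable. For every $\Sigma$-structure $M$ define $$i^\tau_M:Co_{\mathbf{K}}(M)\to(\mathcal{P}(M),\subseteq),\qquad \theta\mapsto\{m\in M\mid \tau^M(m)\subseteq\theta\}.$$ Then $i^\tau=(i^\tau_M)_M$ is a natural transformation (i.e. $i^\tau_M\circ Co_{\mathbf{K}}(f)=f^{-1}\circ i^\tau_N$ for every homomorphism $f:M\to N$), and for every $\Sigma$-structure $M$ the map $i^\tau_M$ preserves arbitrary infima and directed suprema; that is, $(Co_{\mathbf{K}},i^\tau)$ is a filter pair.
   Context: An equation in at most one variable $x$ is a pair $\langle\epsilon,\delta\rangle$ of $\Sigma$-terms in at most the variable $x$. For $m\in M$, $\tau^M(m)=\{\langle\epsilon^M(m),\delta^M(m)\rangle\mid\langle\epsilon,\delta\rangle\in\tau\}\subseteq M\times M$. $\Sigma$-Str is the category of $\Sigma$-structures and homomorphisms. $AL$ is the category of algebraic lattices with maps preserving arbitrary meets and directed joins. A filter pair over $\Sigma$ is a pair $(G,i)$ of a contravariant functor $G:\Sigma\text{-Str}\to AL$ and maps $i_A:G(A)\to(\mathcal{P}(A),\subseteq)$, one for each $\Sigma$-structure $A$, preserving arbitrary infima (in particular $i_A(\top)=A$) and directed suprema, such that $i_A\circ G(h)=h^{-1}\circ i_B$ for every homomorphism $h:A\to B$. A quasivariety is a class of $\Sigma$-structures axiomatizable by quasi-identities. $Co_{\mathbf{K}}(A)$ is the set of congruences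 $\theta$ on $A$ with $A/\theta\in\mathbf{K}$, ordered by inclusion (an algebraic lattice, since $\mathbf{K}$ is a quasivariety), and $Co_{\mathbf{K}}(f)=(f\times f)^{-1}$ for a homomorphism $f$; this is a contravariant functor $\Sigma\text{-Str}\to AL$. *)

(* Defs.v *)
From HB Require Import structures.
From mathcomp Require Import all_boot all_order.
From mathcomp Require Import boolp classical_sets functions cardinality.

Set Implicit Arguments.
Unset Strict Implicit.
Unset Printing Implicit Defensive.

Local Open Scope classical_set_scope.
Local Open Scope order_scope.

Record signature := Signature { symbol : Type; arity : symbol -> nat }.

(* Signatures are algebraic and finitary; carriers may be empty. *)
Record structure (S : signature) := Structure {
  carrier :> Type;
  op : forall f : symbol S, ('I_(arity f) -> carrier) -> carrier }.
Arguments op {S A} f a : rename.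

Record hom (S : signature) (A B : structure S) := Hom {
  hom_fun :> A -> B;
  homP : forall (f : symbol S) (a : 'I_(arity f) -> A),
    hom_fun (op f a) = op f (hom_fun \o a) }.

Definition hom_id (S : signature) (A : structure S) : hom A A :=
  @Hom S A A id (fun f a => erefl).

Lemma hom_compP (S : signature) (A B C : structure S) (h : hom A B)
    (g : hom B C) (f : symbol S) (a : 'I_(arity f) -> A) :
  g (h (op f a)) = op f (fun i => g (h (a i))).
Proof. by rewrite !homP. Qed.

Definition hom_comp (S : signature) (A B C : structure S) (g : hom B C)
    (h : hom A B) : hom A C :=
  @Hom S A C (fun x => g (h x)) (@hom_compP S A B C h g).

Inductive term (S : signature) (V : Type) : Type :=
  | Var of V
  | App (f : symbol S) of ('I_(arity f) -> term S V).
Arguments Var {S V}.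
Arguments App {S V}.

Fixpoint eval (S : signature) (V : Type) (A : structure S) (v : V -> A)
    (t : term S V) : A :=
  match t with
  | Var x => v x
  | App f ts => op f (fun i => eval v (ts i))
  end.

Definition equation (S : signature) (V : Type) : Type :=
  (term S V * term S V)%type.

(* The single variable is the element of [unit]. *)
Definition unary_equation (S : signature) : Type := equation S unit.

(* The set written tau^A(m). *)
Definition eval_equations (S : signature) (tau : set (unary_equation S))
    (A : structure S) (m : A) : set (A * A) :=
  [set (eval (fun=> m) e.1, eval (fun=> m) e.2) | e in tau].

Record quasi_identity (S : signature) := QuasiIdentity {
  premises : set (equation S nat);
  premises_finite : finite_set premises;
  conclusion : equation S nat }.

Definition satisfies_eq (S : signature) (A : structure S) (v : nat -> A)
    (e : equation S nat) : Prop := eval v e.1 = eval v e.2.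

Definition satisfies (S : signature) (A : structure S)
    (q : quasi_identity S) : Prop :=
  forall v : nat -> A,
    (forall e, premises q e -> satisfies_eq v e) ->
    satisfies_eq v (conclusion q).

Definition is_quasivariety (S : signature) (K : structure S -> Prop) : Prop :=
  exists Q : set (quasi_identity S),
    forall A, K A <-> (forall q, Q q -> satisfies A q).

Record quasivariety (S : signature) := Quasivariety {
  qv_class :> structure S -> Prop;
  quasivarietyP : is_quasivariety qv_class }.

Record is_congruence (S : signature) (A : structure S) (th : set (A * A)) :
    Prop := IsCongruence {
  cong_refl : forall x, th (x, x);
  cong_sym : forall x y, th (x, y) -> th (y, x);
  cong_trans : forall x y z, th (x, y) -> th (y, z) -> th (x, z);
  cong_op : forall (f : symbol S) (a b : 'I_(arity f) -> A),
    (forall i, th (a i, b i)) -> th (op f a, op f b) }.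

Record congruence (S : signature) (A : structure S) := Congruence {
  cong_rel :> set (A * A);
  congP : is_congruence cong_rel }.

(* The elements of A/th are the equivalence classes of th. *)
Record quotient_carrier (S : signature) (A : structure S) (th : congruence A) :=
  QuotientClass {
    class_set : set A;
    class_setP : exists x, class_set = [set y | cong_rel th (x, y)] }.

Definition quotient_class (S : signature) (A : structure S)
    (th : congruence A) (x : A) : quotient_carrier th :=
  QuotientClass (ex_intro _ x erefl).

Definition class_repr (S : signature) (A : structure S) (th : congruence A)
    (c : quotient_carrier th) : A := sval (cid (class_setP c)).

(* Independent of the choice of representatives: see [quotient_opE]. *)
Definition quotient (S : signature) (A : structure S) (th : congruence A) :
    structure S :=
  @Structure S (quotient_carrier th)
    (fun f c => quotient_class th (op f (fun i => class_repr (c i)))).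

Lemma quotient_classE (S : signature) (A : structure S) (th : congruence A)
    (x y : A) : quotient_class th x = quotient_class th y <-> cong_rel th (x, y).
Proof.
case: (congP th) => thR thS thT _; split=> [[eqxy]|thxy].
  by have := thR y; rewrite -[cong_rel th _]/([set z | cong_rel th (y, z)] y)
    -eqxy.
have eqxy : [set z | cong_rel th (x, z)] = [set z | cong_rel th (y, z)].
  by apply/seteqP; split=> z /=; apply: thT => //; apply: thS.
rewrite /quotient_class; move: (ex_intro _ x _) (ex_intro _ y _).
by rewrite eqxy => p q; congr QuotientClass; apply: Prop_irrelevance.
Qed.

Lemma class_reprK (S : signature) (A : structure S) (th : congruence A)
    (c : quotient_carrier th) : quotient_class th (class_repr c) = c.
Proof.
rewrite /class_repr; case: cid => x /= eqc.
case: c eqc => C Cp /= eqC; subst C.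
by congr QuotientClass; apply: Prop_irrelevance.
Qed.

Lemma quotient_opE (S : signature) (A : structure S) (th : congruence A)
    (f : symbol S) (a : 'I_(arity f) -> A) :
  quotient_class th (op f a) =
  op (A := quotient th) f (fun i => quotient_class th (a i)).
Proof.
apply/quotient_classE; apply: (cong_op (congP th)) => i.
by apply/quotient_classE; rewrite class_reprK.
Qed.

Lemma eval_quotient (S : signature) (V : Type) (A : structure S)
    (th : congruence A) (v : V -> A) (t : term S V) :
  eval (A := quotient th) (fun x => quotient_class th (v x)) t =
  quotient_class th (eval v t).
Proof.
elim: t => [//|f ts IH].
by rewrite [RHS]quotient_opE /=; congr quotient_class; congr op;
   apply/funext => i; rewrite IH.
Qed.

Lemma satisfies_quotient (S : signature) (A : structure S) (th : congruence A)
    (q : quasi_identity S) :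
  satisfies (quotient th) q <->
  forall v : nat -> A,
    (forall e, premises q e -> cong_rel th (eval v e.1, eval v e.2)) ->
    cong_rel th (eval v (conclusion q).1, eval v (conclusion q).2).
Proof.
split=> [sq v hv|sq v hv].
  have := sq (fun n => quotient_class th (v n)).
  rewrite /satisfies_eq !eval_quotient quotient_classE; apply=> e eq.
  by rewrite !eval_quotient quotient_classE; apply: hv.
have [w eqv] : exists w : nat -> A, v = fun n => quotient_class th (w n).
  by exists (fun n => class_repr (v n)); apply/funext => n; rewrite class_reprK.
subst v; move: hv; rewrite /satisfies_eq !eval_quotient quotient_classE.
by move=> hv; apply: sq => e /hv; rewrite /satisfies_eq !eval_quotient
   quotient_classE.
Qed.

Record Co (S : signature) (K : quasivariety S) (A : structure S) := MkCo {
  Co_cong :> congruence A;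
  CoP : K (quotient Co_cong) }.

HB.instance Definition _ (S : signature) (K : quasivariety S)
  (A : structure S) := gen_eqMixin (Co K A).
HB.instance Definition _ (S : signature) (K : quasivariety S)
  (A : structure S) := gen_choiceMixin (Co K A).

Definition Co_le (S : signature) (K : quasivariety S) (A : structure S)
    (th ph : Co K A) : bool := `[< (th : set (A * A)) `<=` ph >].

Lemma Co_le_refl (S : signature) (K : quasivariety S) (A : structure S) :
  reflexive (@Co_le S K A).
Proof. by move=> th; apply/asboolP. Qed.

Lemma Co_le_anti (S : signature) (K : quasivariety S) (A : structure S) :
  antisymmetric (@Co_le S K A).
Proof.
move=> [[th thC] thK] [[ph phC] phK] /andP[/asboolP /= le1 /asboolP /= le2].
have eqth : th = ph by apply/seteqP.
subst ph; have eqC := Prop_irrelevance thC phC.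
by subst phC; congr MkCo; apply: Prop_irrelevance.
Qed.

Lemma Co_le_trans (S : signature) (K : quasivariety S) (A : structure S) :
  transitive (@Co_le S K A).
Proof.
move=> ph th ps /asboolP le1 /asboolP le2.
by apply/asboolP; apply: subset_trans le2.
Qed.

HB.instance Definition _ (S : signature) (K : quasivariety S)
  (A : structure S) := Order.Le_isPOrder.Build set_display (Co K A)
  (@Co_le_refl S K A) (@Co_le_anti S K A) (@Co_le_trans S K A).

Definition pair_map (T U : Type) (f : T -> U) (p : T * T) : U * U :=
  (f p.1, f p.2).

Lemma preim_congP (S : signature) (A B : structure S) (h : hom A B)
    (th : congruence B) : is_congruence (pair_map h @^-1` th).
Proof.
case: (congP th) => thR thS thT thO; split; rewrite /pair_map /=.
- by move=> x; apply: thR.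
- by move=> x y; apply: thS.
- by move=> x y z; apply: thT.
- by move=> f a b thab; rewrite !homP; apply: thO.
Qed.

Definition preim_cong (S : signature) (A B : structure S) (h : hom A B)
    (th : congruence B) : congruence A := Congruence (preim_congP h th).

Lemma eval_hom (S : signature) (V : Type) (A B : structure S) (h : hom A B)
    (v : V -> A) (t : term S V) : eval (fun x => h (v x)) t = h (eval v t).
Proof.
elim: t => [//|f ts IH] /=; rewrite homP.
by congr op; apply/funext => i; rewrite IH.
Qed.

Lemma preim_congK (S : signature) (K : quasivariety S) (A B : structure S)
    (h : hom A B) (th : Co K B) : K (quotient (preim_cong h th)).
Proof.
case: (quasivarietyP K) => Q KQ; apply/KQ => q Qq.
apply/satisfies_quotient => v hv; rewrite /= /pair_map /= -!eval_hom.
move: ((KQ _).1 (CoP th) q Qq) => /satisfies_quotient; apply=> e eq.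
by rewrite !eval_hom; apply: hv.
Qed.

Definition Co_map (S : signature) (K : quasivariety S) (A B : structure S)
    (h : hom A B) (th : Co K B) : Co K A := MkCo (preim_congK h th).

Definition directed (d : Order.disp_t) (L : porderType d) (X : set L) : Prop :=
  X !=set0 /\
  forall x y, X x -> X y -> exists z, [/\ X z, x <= z & y <= z].

Definition complete_lattice (d : Order.disp_t) (L : porderType d) : Prop :=
  forall X : set L, supremums X !=set0 /\ infimums X !=set0.

Definition compact_element (d : Order.disp_t) (L : porderType d) (c : L) :
    Prop :=
  forall (X : set L) (s : L), supremums X s -> c <= s ->
    exists F t, [/\ F `<=` X, finite_set F, supremums F t & c <= t].

Definition algebraic_lattice (d : Order.disp_t) (L : porderType d) : Prop :=
  complete_lattice L /\
  forall x : L, exists2 X : set L,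
    (forall c, X c -> compact_element c) & supremums X x.

(* [X] ranges over all subsets, so that the top element is preserved too. *)
Definition preserves_infima (d d' : Order.disp_t) (L : porderType d)
    (L' : porderType d') (f : L -> L') : Prop :=
  forall (X : set L) (m : L), infimums X m -> infimums (f @` X) (f m).

Definition preserves_directed_suprema (d d' : Order.disp_t)
    (L : porderType d) (L' : porderType d') (f : L -> L') : Prop :=
  forall (X : set L) (s : L),
    directed X -> supremums X s -> supremums (f @` X) (f s).

Definition AL_morphism (d d' : Order.disp_t) (L : porderType d)
    (L' : porderType d') (f : L -> L') : Prop :=
  preserves_infima f /\ preserves_directed_suprema f.

Record is_AL_functor (S : signature) (d : Order.disp_t)
    (G : structure S -> porderType d)
    (Gmap : forall A B : structure S, hom A B -> G B -> G A) : Prop :=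
  IsALFunctor {
    functor_obj : forall A, algebraic_lattice (G A);
    functor_mor : forall (A B : structure S) (h : hom A B),
      AL_morphism (Gmap A B h);
    functor_id : forall A : structure S, Gmap A A (hom_id A) =1 id;
    functor_comp : forall (A B C : structure S) (g : hom B C) (h : hom A B),
      Gmap A C (hom_comp g h) =1 Gmap A B h \o Gmap B C g }.

Definition is_natural (S : signature) (d : Order.disp_t)
    (G : structure S -> porderType d)
    (Gmap : forall A B : structure S, hom A B -> G B -> G A)
    (i : forall A : structure S, G A -> set A) : Prop :=
  forall (A B : structure S) (h : hom A B) (x : G B),
    i A (Gmap A B h x) = h @^-1` (i B x).

Record is_filter_pair (S : signature) (d : Order.disp_t)
    (G : structure S -> porderType d)
    (Gmap : forall A B : structure S, hom A B -> G B -> G A)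
    (i : forall A : structure S, G A -> set A) : Prop := IsFilterPair {
  filter_pair_functor : is_AL_functor Gmap;
  filter_pair_infima : forall A, preserves_infima (i A);
  filter_pair_suprema : forall A, preserves_directed_suprema (i A);
  filter_pair_natural : is_natural Gmap i }.

Definition filter_of (S : signature) (K : quasivariety S)
    (tau : set (unary_equation S)) (A : structure S) (th : Co K A) : set A :=
  [set m | eval_equations tau m `<=` th].

(* Main.v *)
Require Import Defs.
From mathcomp Require Import all_boot all_order.
From mathcomp Require Import boolp classical_sets functions cardinality.

(** [Co K A] is closed under intersections and directed unions of relations: a
quasi-identity has finitely many premises and an operation finitely many
arguments, so all the pairs involved in one instance already lie in a single
member of a directed family. Infima and directed suprema in [Co K A] are
therefore computed on the underlying relations, where inverse images commute
with them; and [filter_of tau] commutes with directed unions because [tau] is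
finite. The compact elements needed for algebraicity are the principal
K-congruences: any supremum is the directed union of the suprema of finite
subfamilies. *)

Set Implicit Arguments.
Unset Strict Implicit.
Unset Printing Implicit Defensive.

Import Order.TTheory.

Local Open Scope classical_set_scope.

(** Induction on a list of the points of [F]: nonemptiness of [X] starts it, and each new point is
    absorbed by passing to an upper bound of two members. *)
Lemma directed_cover (d : Order.disp_t) (L : porderType d) (T : Type)
    (e : L -> set T) (X : set L) (F : set T) :
  {homo e : x y / (x <= y)%O >-> x `<=` y} -> directed X -> finite_set F ->
  F `<=` \bigcup_(x in X) e x -> exists2 x, X x & F `<=` e x.
Proof.
(* [finite_seqP] needs decidable equality, which [Pchoice] supplies for an arbitrary type. *)
move=> e_le [[x0 Xx0] Xdir]; elim/Pchoice: T => T in e F e_le *.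
move=> /finite_seqP[s ->{F}]; elim: s => [|a s IH] sX; first by exists x0.
have [x Xx sx] : exists2 x, X x & [set` s] `<=` e x.
  by apply: IH => b /= bs; apply: sX; rewrite /= inE bs orbT.
have [y Xy ya] : (\bigcup_(x in X) e x) a by apply: sX; rewrite /= mem_head.
have [z [Xz xz yz]] := Xdir _ _ Xx Xy.
exists z => // b /=; rewrite inE => /predU1P[->|bs]; first exact: (e_le y).
exact/(e_le x)/sx.
Qed.

Section Embedding.
Variables (d : Order.disp_t) (L : porderType d) (T : Type) (e : L -> set T).
Hypothesis e_le : forall x y, (x <= y)%O <-> e x `<=` e y.

(** [e] is an order embedding into a powerset: below, either the underlying relation of a congruence
    or the identity on a powerset. *)
Lemma infimums_bigcap (X : set L) (m : L) :
  e m = \bigcap_(x in X) e x -> infimums X m.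
Proof.
move=> em; split=> [x Xx|y ly]; apply/e_le; rewrite em; first exact: bigcap_inf.
by apply: sub_bigcap => x Xx; apply/e_le/ly.
Qed.

Lemma supremums_bigcup (X : set L) (s : L) :
  e s = \bigcup_(x in X) e x -> supremums X s.
Proof.
move=> es; split=> [x Xx|y uy]; apply/e_le; rewrite es; first exact: bigcup_sup.
by apply: bigcup_sub => x Xx; apply/e_le/uy.
Qed.

End Embedding.

Section RelativeCongruences.
Variables (S : signature) (K : quasivariety S).
Implicit Types A B : structure S.

Lemma Co_leE A (th ph : Co K A) : (th <= ph)%O <-> (th : set (A * A)) `<=` ph.
Proof. by split=> /asboolP. Qed.

Lemma Co_ext A (th ph : Co K A) : (th : set (A * A)) = ph -> th = ph.
Proof. by move=> e; apply/le_anti/andP; split; apply/Co_leE; rewrite e. Qed.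

(** The axioms of [K] hold in every quotient by a member of [Co K A], so closure proofs can treat
    one quasi-identity at a time without naming an axiomatization. *)
Lemma Co_intro A (r : set (A * A)) (rP : is_congruence r) :
  (forall q : quasi_identity S,
     (forall th : Co K A, satisfies (quotient th) q) ->
     satisfies (quotient (Congruence rP)) q) ->
  exists th : Co K A, th = r :> set (A * A).
Proof.
move=> rQ; have [Q KQ] := quasivarietyP K.
have rK : K (quotient (Congruence rP)).
  by apply/KQ => q Qq; apply: rQ => th; exact: (KQ _).1 (CoP th) q Qq.
by exists (MkCo rK).
Qed.

Lemma Co_bigcap A (X : set (Co K A)) :
  exists m : Co K A, m = \bigcap_(th in X) (th : set (A * A)) :> set (A * A).
Proof.
have rP : is_congruence (\bigcap_(th in X) (th : set (A * A))).
  split=> [x th _|x y xy th Xth|x y z xy yz th Xth|f a b ab th Xth].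
  - exact: (cong_refl (congP th)).
  - by apply: (cong_sym (congP th)); exact: xy.
  - by apply: (cong_trans (congP th)); [exact: xy|exact: yz].
  - by apply: (cong_op (congP th)) => i; exact: ab.
apply: (Co_intro (rP := rP)) => q Kq; apply/satisfies_quotient => v hv th Xth.
by have /satisfies_quotient := Kq th; apply=> e qe; exact: hv.
Qed.

Lemma Co_bigcup A (X : set (Co K A)) : directed X ->
  exists s : Co K A, s = \bigcup_(th in X) (th : set (A * A)) :> set (A * A).
Proof.
move=> Xdir; have [[th0 Xth0] _] := Xdir.
(* Applied below to two chained pairs, to the argument pairs of an operation and to the premises of
   a quasi-identity. *)
have cover F := directed_cover (F := F) (fun x y => (Co_leE x y).1) Xdir.
have rP : is_congruence (\bigcup_(th in X) (th : set (A * A))).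
  split=> [x|x y [th Xth xy]|x y z xy yz|f a b ab].
  - by exists th0 => //; exact: (cong_refl (congP th0)).
  - by exists th => //; exact: (cong_sym (congP th)).
  - have [|p|th Xth sth] := cover [set (x, y); (y, z)]; first exact: finite_set2.
      by move=> [->|->].
    exists th => //; apply: (cong_trans (congP th) (y := y)).
      by apply: sth; left.
    by apply: sth; right.
  - have [|_ [i _ <-]|th Xth sth] := cover (range (fun i => (a i, b i))).
    + exact/finite_image/finite_finset.
    + exact: ab.
    exists th => //; apply: (cong_op (congP th)) => i.
    by apply: sth; exists i.
apply: (Co_intro (rP := rP)) => q Kq; apply/satisfies_quotient => v hv.
have [|_ [e qe <-]|th Xth sth] :=
    cover ((fun e => (eval v e.1, eval v e.2)) @` premises q).
- exact/finite_image/premises_finite.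
- exact: hv.
exists th => //; have /satisfies_quotient := Kq th; apply=> e qe.
by apply: sth; exists e.
Qed.

(** The intersection is itself an infimum, and infima are unique. *)
Lemma Co_infimumsE A (X : set (Co K A)) (m : Co K A) : infimums X m ->
  m = \bigcap_(th in X) (th : set (A * A)) :> set (A * A).
Proof.
have [m' m'E] := Co_bigcap X => /(is_subset1_infimums).
by move=> /(_ _ (infimums_bigcap (@Co_leE A) m'E)) ->.
Qed.

Lemma Co_supremumsE A (X : set (Co K A)) (s : Co K A) :
  directed X -> supremums X s ->
  s = \bigcup_(th in X) (th : set (A * A)) :> set (A * A).
Proof.
move=> /Co_bigcup[s' s'E] /(is_subset1_supremums).
by move=> /(_ _ (supremums_bigcup (@Co_leE A) s'E)) ->.
Qed.

Lemma Co_complete A : complete_lattice (Co K A).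
Proof.
move=> X; split; last first.
  by have [m /(infimums_bigcap (@Co_leE A)) mX] := Co_bigcap X; exists m.
(* The supremum is the intersection of all upper bounds. *)
have [s /(infimums_bigcap (@Co_leE A)) [lbs gts]] := Co_bigcap (ubound X).
by exists s; split=> // x Xx; apply: gts => y; apply.
Qed.

(** The empty subfamily gives nonemptiness, and the union of two finite subfamilies gives the common
    upper bound. *)
Lemma finite_sups_directed A (X : set (Co K A)) :
  directed [set t | exists F, [/\ F `<=` X, finite_set F & supremums F t]].
Proof.
split.
  have [[t t0] _] := Co_complete (set0 : set (Co K A)).
  by exists t, set0; split=> //; exact: sub0set.
move=> t u [F [FX Ffin [Ft tF]]] [G [GX Gfin [Gu uG]]].
have [[v vFG] _] := Co_complete (F `|` G); exists v; split.
- exists (F `|` G); split=> //; first by rewrite subUset.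
  by rewrite finite_setU.
- by apply: tF => x Fx; apply: vFG.1; left.
- by apply: uG => x Gx; apply: vFG.1; right.
Qed.

(** The K-congruence generated by [p]. *)
Definition principal A (p : A * A) : Co K A :=
  sval (cid (Co_bigcap [set th : Co K A | (th : set (A * A)) p])).

Lemma principal_leE A (p : A * A) (th : Co K A) :
  (principal p <= th)%O <-> (th : set (A * A)) p.
Proof.
rewrite Co_leE /principal; case: cid => c /= ->.
by split=> [|thp]; [apply=> th'; apply|exact: bigcap_inf].
Qed.

Lemma principal_compact A (p : A * A) : compact_element (principal p).
Proof.
move=> X s [_ s_least] /principal_leE sp.
have [U UE] := Co_bigcup (finite_sups_directed X).
(* Each member of [X] is the supremum of its own singleton, so [U] bounds [X]. The pair [p] then
   lies in one of the relations whose union is [U]. *)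
have sU : (s <= U)%O.
  apply: s_least => x Xx; apply/Co_leE; rewrite UE.
  apply: (bigcup_sup (i := x)); exists [set x].
  split; first by move=> _ ->.
    exact: finite_set1.
  by rewrite supremums1.
move: sp => /((Co_leE _ _).1 sU); rewrite UE => -[t [F [FX Ffin Ft]] tp].
by exists F, t; split=> //; apply/principal_leE.
Qed.

Lemma Co_algebraic A : algebraic_lattice (Co K A).
Proof.
split=> [|th]; first exact: Co_complete.
(* A K-congruence is the supremum of the principal ones generated by its own pairs. *)
exists (@principal A @` (th : set (A * A))).
  by move=> _ [p _ <-]; exact: principal_compact.
split=> [_ [p thp <-]|ph uph]; first exact/principal_leE.
by apply/Co_leE => p thp; apply/principal_leE/uph; exists p.
Qed.

Lemma Co_map_morphism A B (h : hom A B) : AL_morphism (@Co_map S K A B h).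
Proof.
split=> [X m /Co_infimumsE mE|X s Xdir /(Co_supremumsE Xdir) sE].
  apply: (infimums_bigcap (@Co_leE A)).
  by rewrite bigcap_image /= mE preimage_bigcap.
apply: (supremums_bigcup (@Co_leE A)).
by rewrite bigcup_image /= sE preimage_bigcup.
Qed.

Lemma Co_functor : is_AL_functor (@Co_map S K).
Proof.
split=> [A|A B h|A th|A B C g h th].
- exact: Co_algebraic.
- exact: Co_map_morphism.
(* [pair_map id p] reduces to [p] only once [p] is destructed. *)
- by apply: Co_ext; apply/seteqP; split=> -[].
- exact: Co_ext.
Qed.

Variable tau : set (unary_equation S).

(** Homomorphisms commute with term evaluation, so [h] carries the pairs of [tau] at [m] to those at
    [h m]. *)
Lemma filter_of_natural : is_natural (@Co_map S K) (@filter_of S K tau).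
Proof.
move=> A B h th.
have evalE m t : eval (fun=> h m) t = h (eval (fun=> m) t) :=
  eval_hom h (fun=> m : A) t.
apply/seteqP; split=> m /= tau_m _ [e te <-] /=.
  by rewrite !evalE; apply: (tau_m (_, _)); exists e.
by rewrite /pair_map /= -!evalE; apply: tau_m; exists e.
Qed.

Lemma filter_of_infima A : preserves_infima (@filter_of S K tau A).
Proof.
move=> X m /Co_infimumsE mE; apply: (infimums_bigcap (e := id)).
  by move=> x y; rewrite subsetEset.
rewrite bigcap_image /filter_of mE; apply/seteqP; split=> a /=.
  by move=> + th Xth => /subset_trans; apply; exact: bigcap_inf.
by move=> Xa; apply: sub_bigcap.
Qed.

Lemma filter_of_suprema A : finite_set tau ->
  preserves_directed_suprema (@filter_of S K tau A).
Proof.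
move=> tau_fin X s Xdir /(Co_supremumsE Xdir) sE.
apply: (supremums_bigcup (e := id)).
  by move=> x y; rewrite subsetEset.
rewrite bigcup_image /filter_of sE; apply/seteqP; split=> a /=.
  (* The pairs of [tau] at [a] form a finite set, so a single member of [X] contains them all. *)
  apply: (directed_cover _ Xdir); last exact: finite_image.
  by move=> x y /Co_leE.
by move=> [th Xth] /subset_trans; apply; exact: (bigcup_sup (i := th)).
Qed.

End RelativeCongruences.

Theorem theorem3p9 (S : signature) (K : quasivariety S)
    (tau : set (unary_equation S)) (tau_finite : finite_set tau) :
  [/\ is_natural (@Co_map S K) (@filter_of S K tau),
      forall M : structure S, preserves_infima (@filter_of S K tau M),
      forall M : structure S,
        preserves_directed_suprema (@filter_of S K tau M)
    & is_filter_pair (@Co_map S K) (@filter_of S K tau)].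
Proof.
have nat := @filter_of_natural S K tau.
have inf := @filter_of_infima S K tau.
have sup M := @filter_of_suprema S K tau M tau_finite.
by split=> //; split=> //; exact: Co_functor.
Qed.
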